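(* Let $X$ be a compact metrizable group and $\alpha\colon X\to X$ a continuous group automorphism. Then the $\mathbb{Z}$-system $(X,\alpha)$ is not CAM.
   Context: A $\mathbb{Z}$-system $(X,T)$ is a compact metric space $X$ with a homeomorphism $T$. It is topologically transitive if for all nonempty open $U,V$ there is $n$ with $T^nU\cap V\neq\emptyset$; the action is faithful if $T^n=\mathrm{id}$ only for $n=0$. A point is periodic if its orbit is finite. The system is chaotic almost minimal (CAM) if: (1) it is topologically transitive and the action is faithful; (2) the periodic points are dense in $X$; (3) every proper closed $T$-invariant subset of $X$ is finite. *)

(* Defs.v *)
From HB Require Import structures.
From mathcomp Require Import all_boot all_order all_algebra.
From mathcomp Require Import all_classical all_reals.
From mathcomp Require Import topology.
Set Implicit Arguments. Unset Strict Implicit. Unset Printing Implicit Defensive.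
Import Order.TTheory GRing.Theory Num.Theory.
Local Open Scope classical_set_scope.

Definition zact {X : Type} (T Tinv : X -> X) (n : int) : X -> X :=
  match n with
  | Posz k => iter k T
  | Negz k => iter k.+1 Tinv
  end.

Definition topologically_transitive {X : topologicalType} (T Tinv : X -> X) : Prop :=
  forall U V : set X, open U -> open V -> U !=set0 -> V !=set0 ->
    exists n : int, (zact T Tinv n @` U) `&` V !=set0.

Definition faithful_action {X : Type} (T Tinv : X -> X) : Prop :=
  forall n : int, zact T Tinv n = id -> n = 0%R.

Definition periodic_point {X : Type} (T Tinv : X -> X) (x : X) : Prop :=
  finite_set [set zact T Tinv n x | n in [set: int]].

Definition T_invariant {X : Type} (T : X -> X) (A : set X) : Prop := T @` A = A.

Definition CAM {X : topologicalType} (T Tinv : X -> X) : Prop :=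
  [/\ topologically_transitive T Tinv /\ faithful_action T Tinv,
      dense [set x | periodic_point T Tinv x] &
      forall A : set X, closed A -> T_invariant T A -> A <> [set: X] -> finite_set A].

Definition topological_group {X : topologicalType}
  (mul : X -> X -> X) (inv : X -> X) (e : X) : Prop :=
  [/\ (forall x y z, mul x (mul y z) = mul (mul x y) z),
      (forall x, mul e x = x /\ mul x e = x),
      (forall x, mul (inv x) x = e /\ mul x (inv x) = e),
      continuous (fun p : X * X => mul p.1 p.2) & continuous inv].

(* Main.v *)
(** Suppose the system is CAM, with [g] the inverse of the automorphism [f].
    Applied to the points whose whole orbit stays in a small closed
    neighbourhood of the unit, almost minimality makes [f] expansive.
    Transitivity and density of periodic points then yield [u <> e] whose
    backward orbit stays near, hence converges to, the unit.  For [m] large the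
    ordered products of [g^m(u)^c_1, g^(2m)(u)^c_2, ...] with [c_i] in [{0, 1}]
    all have their backward orbits near [e], and distinct sequences are
    separated at a time governed by the first difference.  Choosing the [c_i] in
    blocks of length [b], where [2^b > b m + 1], one can keep the forward orbit
    of a suitable product out of a small open set [V]; no commutativity is
    needed.  This produces a nonperiodic point whose orbit visits [V] finitely
    often.  Removing these visits from [V] leaves a nonempty open set, since it
    still contains a periodic point, so the orbit lies in a proper closed
    invariant set, which is infinite. *)
Require Import Defs.
From HB Require Import structures.
From mathcomp Require Import all_boot all_order all_algebra.
From mathcomp Require Import all_classical all_reals.
From mathcomp Require Import topology.
From mathcomp Require Import zify.
Local Open Scope classical_set_scope.

(** * Compactness through sequences and nested closed sets *)

Section CompactSequences.
Context {X : topologicalType}.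
Hypothesis X_compact : compact [set: X].

(** A cluster point of the sequence. Testing it on closed sets is all that is used later, so no
    subsequence is extracted. *)
Lemma compact_limit_point (x : nat -> X) :
  exists y, forall C : set X, closed C -> (\forall n \near \oo, C (x n)) -> C y.
Proof.
have [|y [_ x_y]] := X_compact (x @ \oo) _; first exact: filterT.
by exists y => C clC Cx; apply: clC => A /x_y; apply.
Qed.

Lemma nested_closed_subset (C : nat -> set X) (O : set X) :
  (forall n, closed (C n)) -> (forall n, C n.+1 `<=` C n) ->
  open O -> \bigcap_n C n `<=` O -> exists n, C n `<=` O.
Proof.
move=> clC decC oO CO; apply: contrapT => /forallNP noC.
have /choice[x xP] n : exists x, C n x /\ ~ O x.
  by have /existsNP[x /not_implyP ?] := noC n; exists x.
have leC m n : (m <= n)%N -> C n `<=` C m.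
  move=> /subnKC <-; elim: (n - m)%N => [|k IH]; first by rewrite addn0.
  by rewrite addnS; apply: subset_trans IH.
have [y yP] := compact_limit_point x.
apply: (yP (~` O)) (CO y _); first exact: open_closedC.
- by near=> n; have [] := xP n.
- move=> n _; apply: (yP _ (clC n)); near=> m.
  by apply: (leC n m); [near: m; exact: nbhs_infty_ge|have [] := xP m].
Unshelve. all: by end_near. Qed.

Lemma continuous_inverse (f g : X -> X) : hausdorff_space X ->
  cancel f g -> cancel g f -> continuous f -> continuous g.
Proof.
move=> hX fK gK cf; apply/continuous_closedP => A clA.
rewrite (_ : g @^-1` A = f @` A); last first.
  by apply/seteqP; split=> [y Ay|_ [y Ay <-]]; [exists (g y)|rewrite /= fK].
apply: compact_closed => //; apply: continuous_compact.
  exact: continuous_subspaceT.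
exact: subclosed_compact clA X_compact _.
Qed.

End CompactSequences.

(** * Iterates of a bijection and periodic points *)

Section Iteration.
Context {X : Type}.

Lemma iter_subn (f g : X -> X) i j x :
  cancel g f -> (i <= j)%N -> iter i f (iter j g x) = iter (j - i) g x.
Proof.
move=> gK; elim: i j => [|i IH] [|j] //=; rewrite ltnS => ij.
by rewrite -iterS iterSr gK IH.
Qed.

Lemma iter_cancel (f g : X -> X) n : cancel g f -> cancel (iter n g) (iter n f).
Proof. by move=> gK x; rewrite iter_subn // subnn. Qed.

Lemma iter_fixed (f : X -> X) x k : f x = x -> iter k f x = x.
Proof. by move=> fx; elim: k => //= k ->. Qed.

(** By pigeonhole two forward iterates agree, and injectivity cancels the earlier one. *)
Lemma finite_orbit_periodic (f : X -> X) (A : set X) x :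
  injective f -> finite_set A -> (forall n, A (iter n f x)) ->
  exists2 n, (0 < n)%N & iter n f x = x.
Proof.
move=> f_inj finA Ax; apply: contrapT => aper; apply: infinite_nat.
rewrite (_ : setT = (fun n => iter n f x) @^-1` A); last first.
  by apply/seteqP; split=> // n _; exact: Ax.
apply: finite_preimage => // i j _ _.
wlog ij : i j / (i <= j)%N => [W|/esym].
  by have [|/ltnW] := leqP i j; [exact: W|move=> ji /esym /(W _ _ ji)].
have iter_inj n : injective (iter n f) by elim: n => //= n IH y z /f_inj/IH.
rewrite -{1}(subnKC ij) iterD => /iter_inj per.
have [?|?] := posnP (j - i)%N; first by lia.
by case: aper; exists (j - i)%N.
Qed.

(** Stepping back [k] places on a cycle is stepping forward [k * n - k], a true subtraction since
    [n > 0]. *)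
Lemma periodic_backward (f g : X -> X) x n k : cancel f g ->
  (0 < n)%N -> iter n f x = x -> iter k g x = iter (k * n - k) f x.
Proof.
move=> fK n0 per; have knx : iter (k * n) f x = x.
  by elim: k => // k IH; rewrite mulSn iterD IH.
by rewrite -{1}knx iter_subn //; nia.
Qed.

End Iteration.

(** * Dynamics near an isolated fixed point *)

Section Dynamics.
Context {X : topologicalType}.
Variables f g : X -> X.
Hypotheses (X_compact : compact [set: X]) (fK : cancel f g) (gK : cancel g f).
Hypotheses (f_cont : continuous f) (g_cont : continuous g).

Definition orbit_inside (B : set X) : set X :=
  [set x | forall n, B (iter n f x) /\ B (iter n g x)].

Definition backward_inside (B : set X) : set X :=
  [set x | forall n, B (iter n g x)].

Lemma iter_continuous (h : X -> X) n : continuous h -> continuous (iter n h).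
Proof.
move=> ch; elim: n => [|n IH] x; first exact: cvg_id.
by apply: (@continuous_comp _ _ _ (iter n h) h); [exact: IH|exact: ch].
Qed.

Lemma closed_iter_preimage (h : X -> X) n (B : set X) :
  continuous h -> closed B -> closed (iter n h @^-1` B).
Proof.
by move=> ch clB; apply: (continuous_closedP _).1 clB; exact: iter_continuous.
Qed.

Lemma closed_orbit_inside B : closed B -> closed (orbit_inside B).
Proof.
move=> clB; rewrite (_ : orbit_inside B =
    \bigcap_n (iter n f @^-1` B `&` iter n g @^-1` B)); last first.
  by apply/seteqP; split=> x /= Bx n; [move=> _|]; exact: Bx.
by apply: closed_bigI => n _; apply: closedI; exact: closed_iter_preimage.
Qed.

Lemma orbit_inside_invariant B : T_invariant f (orbit_inside B).
Proof.
apply/seteqP; split=> [_ [x Bx <-]|x Bx] /=.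
  move=> n; rewrite -iterSr; split; first by have [] := Bx n.+1.
  case: n => [|n]; first by have [] := Bx 1%N.
  by rewrite iterSr fK; have [] := Bx n.
exists (g x); last exact: gK.
move=> n; rewrite -iterSr; split; last by have [] := Bx n.+1.
case: n => [|n]; first by have [] := Bx 1%N.
by rewrite iterSr gK; have [] := Bx n.
Qed.

Section FixedPoint.
Variables (e : X) (B : set X).
Hypotheses (fe : f e = e) (Be : nbhs e B) (clB : closed B).
Hypothesis isolating : orbit_inside B `<=` [set e].

(** The closed sets [C M] decrease to a subset of [orbit_inside f g B], hence of [[set e]], so some
    [C M] lies in [W]. Past time [M] every backward orbit staying in [B] is in that [C M], which
    makes [M] uniform in [x]. *)
Lemma backward_contraction (W : set X) : nbhs e W ->
  exists M, forall x j, backward_inside B x -> (M <= j)%N -> W (iter j g x).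
Proof.
move=> We.
pose C M := [set x | backward_inside B x /\
                     forall i, (i <= M)%N -> B (iter i f x)].
have [M CM] : exists M, C M `<=` W^°.
  apply: nested_closed_subset => //.
  - move=> M; rewrite (_ : C M = \bigcap_n (iter n g @^-1` B) `&`
        \bigcap_(i in [set i | (i <= M)%N]) (iter i f @^-1` B)); last first.
      by apply/seteqP; split=> x [gx fx]; split=> // n; [move=> _|]; exact: gx.
    by apply: closedI; apply: closed_bigI => n _; exact: closed_iter_preimage.
  - by move=> M x [gx fx]; split=> // i iM; apply: fx; exact: leqW.
  - exact: open_interior.
  - move=> x Cx; rewrite (_ : x = e) //; apply: isolating => n.
    by have [gx fx] := Cx n I; split; [exact: fx|exact: gx].
exists M => x j gx Mj; suff /CM/interior_subset : C M (iter j g x) by []; split=> [n|i iM].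
  by rewrite -iterD; exact: gx.
by rewrite iter_subn //; exact: leq_trans iM Mj.
Qed.

(* Otherwise, by compactness, finitely many conditions [B (iter j g x)] define
   a neighbourhood of [e] that [f] maps into itself; a periodic point other
   than [e] in there has its orbit in [B]. *)
Lemma unstable_point :
  dense [set x | exists2 n, (0 < n)%N & iter n f x = x] ->
  closed [set e] -> ~ open [set e] ->
  exists2 u, u <> e & backward_inside B u.
Proof.
move=> dper cle iso; apply: contrapT => nou.
have back_e x : backward_inside B x -> x = e.
  by move=> Bx; apply: contrapT => xe; apply: nou; exists x.
pose C N := [set x | forall j, (j <= N)%N -> B (iter j g x)].
have ge : g e = e by rewrite -{1}fe fK.
have [N CN] : exists N, C N `<=` f @^-1` (B^°).
  apply: nested_closed_subset => //.
  - move=> N; rewrite (_ : C N =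
        \bigcap_(j in [set j | (j <= N)%N]) (iter j g @^-1` B)) //.
    by apply: closed_bigI => n _; exact: closed_iter_preimage.
  - by move=> N x Cx j jN; apply: Cx; exact: leqW.
  - by apply: open_comp; [move=> x _; exact: f_cont|exact: open_interior].
  - move=> x Cx; rewrite (back_e x) /= ?fe //.
    by move=> n; exact: Cx n I _ (leqnn n).
have fC x : C N x -> C N (f x).
  move=> Cx [|j] jN; first by have /interior_subset := CN _ Cx.
  by rewrite iterSr fK; apply: Cx; exact: ltnW.
have Ce : nbhs e (C N).
  elim: {CN fC} N => [|N IH].
    by apply: filterS Be => x Bx j; rewrite leqn0 => /eqP ->.
  have BN : nbhs e (iter N.+1 g @^-1` B).
    by apply: (iter_continuous g N.+1 g_cont); rewrite iter_fixed.
  apply: filterS (filterI IH BN) => x [Cx Bx] j.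
  by rewrite leq_eqVlt => /predU1P[->//|]; rewrite ltnS; exact: Cx.
have [q [[Cq qe]] [n n0 per]] : ((C N)^° `\ e) `&`
    [set x | exists2 n, (0 < n)%N & iter n f x = x] !=set0.
  apply: dper; last first.
    apply: openI; first exact: open_interior.
    exact: closed_openC.
  apply: contrapT => C0; apply: iso.
  rewrite (_ : [set e] = (C N)^°); first exact: open_interior.
  apply/seteqP; split=> [_ -> //|x Cx]; apply: contrapT => xe.
  by apply: C0; exists x.
have fq k : B (iter k f q).
  suff : C N (iter k f q) by move/(_ 0%N); exact.
  by elim: k => [|k IH]; [exact: interior_subset|exact: fC].
apply: qe; apply: isolating => k; split; first exact: fq.
by rewrite (periodic_backward f g q n k).
Qed.

End FixedPoint.
End Dynamics.

(** * Group identities for the automorphism and its inverse *)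

Section Automorphism.
Context {X : topologicalType}.
Variables (mul : X -> X -> X) (inv : X -> X) (e : X) (f g : X -> X).
Hypotheses (X_compact : compact [set: X]) (X_group : topological_group mul inv e).
Hypotheses (fM : forall x y, f (mul x y) = mul (f x) (f y)).
Hypotheses (fK : cancel f g) (gK : cancel g f).
Hypotheses (f_cont : continuous f) (g_cont : continuous g).

Local Notation "x ** y" := (mul x y) (at level 40, left associativity).

Let mulA : associative mul. Proof. by case: X_group. Qed.
Let mul1 : left_id e mul. Proof. by case: X_group => _ h _ _ _ x; case: (h x). Qed.
Let mule : right_id e mul. Proof. by case: X_group => _ h _ _ _ x; case: (h x). Qed.
Let mulV : left_inverse e inv mul.
Proof. by case: X_group => _ _ h _ _ x; case: (h x). Qed.
Let mulVr : right_inverse e inv mul.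
Proof. by case: X_group => _ _ h _ _ x; case: (h x). Qed.

Let mulKl x y : inv x ** (x ** y) = y. Proof. by rewrite mulA mulV mul1. Qed.
Let mulVK x y : x ** (inv x ** y) = y. Proof. by rewrite mulA mulVr mul1. Qed.

Let inv_unique x y : x ** y = e -> y = inv x.
Proof. by move=> xy; rewrite -[inv x]mule -xy mulKl. Qed.

Let invM x y : inv (x ** y) = inv y ** inv x.
Proof. by apply/esym/inv_unique; rewrite -mulA mulVK mulVr. Qed.

Let inv1 : inv e = e. Proof. by apply/esym/inv_unique; rewrite mul1. Qed.

Let f1 : f e = e.
Proof. by rewrite -[LHS](mulKl (f e)) -fM mul1 mulV. Qed.

Let g1 : g e = e. Proof. by rewrite -{1}f1 fK. Qed.

Let gM x y : g (x ** y) = g x ** g y.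
Proof. by apply: (can_inj fK); rewrite fM !gK. Qed.

Let iter_mul h n x y : (forall x y, h (x ** y) = h x ** h y) ->
  iter n h (x ** y) = iter n h x ** iter n h y.
Proof. by move=> hM; elim: n => //= n ->. Qed.

Let iter_inv h n x : h e = e -> (forall x y, h (x ** y) = h x ** h y) ->
  iter n h (inv x) = inv (iter n h x).
Proof. by move=> h1 hM; apply: inv_unique; rewrite -iter_mul// mulVr iter_fixed. Qed.

Let mul_cvg (T : Type) (F : set_system T) (a b : T -> X) x y : Filter F ->
  a @ F --> x -> b @ F --> y -> (fun t => a t ** b t) @ F --> x ** y.
Proof.
move=> FF ax bY; apply: (continuous2_cvg _ _ ax bY).
by case: X_group => _ _ _ + _; move=> /(_ (x, y)).
Qed.

Let inv_cvg (T : Type) (F : set_system T) (a : T -> X) x : Filter F ->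
  a @ F --> x -> (fun t => inv (a t)) @ F --> inv x.
Proof.
move=> FF ax; apply: (continuous_cvg _ _ ax).
by case: X_group => _ _ _ _; move=> /(_ x).
Qed.

(** * Ordered products coded by binary words *)

Section Words.
Variables (u : X) (m : nat).

(** Horner form of [g^m(u^c_1) g^(2m)(u^c_2) ...]: applying [f^m] frees the first letter and leaves
    the point of the remaining word. *)
Fixpoint word_point (w : seq bool) : X :=
  if w is c :: w' then iter m g ((if c then u else e) ** word_point w') else e.

Lemma iter_word_point_cat w w' :
  iter (size w * m) f (word_point (w ++ w')) =
  iter (size w * m) f (word_point w) ** word_point w'.
Proof.
elim: w => [|c w IH]; first by rewrite mul0n mul1.
rewrite cat_cons /= mulSn addnC !iterD !iter_cancel //.
by rewrite !iter_mul // IH mulA.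
Qed.

Variables B U W N : set X.
Hypotheses (UWB : forall x y, U x -> W y -> B (x ** y)) (Ue : U e) (We : W e).
Hypothesis contraction :
  forall x j, backward_inside g B x -> (m <= j)%N -> W (iter j g x).
Hypothesis Uu : backward_inside g U u.

Lemma backward_mul x y : backward_inside g U x -> backward_inside g W y ->
  backward_inside g B (x ** y).
Proof. by move=> Ux Wy n; rewrite iter_mul //; exact: UWB. Qed.

(** A letter times a point staying backward in [W] stays backward in [B], and [m] applications of
    [g] contract it into [W] again, which closes the induction. *)
Lemma backward_word_point w : backward_inside g W (word_point w).
Proof.
elim: w => [|c w IH] n /=; first by rewrite iter_fixed.
rewrite -iterD; apply: contraction; last exact: leq_addl.
apply: backward_mul => //; case: c => // k.
by rewrite iter_fixed.
Qed.

Hypothesis WN : forall s t, W s -> W t ->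
  ~ N (inv (u ** s) ** t) /\ ~ N (inv s ** (u ** t)).

(** Here [i] is the position, counted from 1, of the first differing letter. The common prefix
    stands on the left of both products and cancels; the rest begins with [u] on exactly one side,
    so [WN] applies. *)
Lemma word_point_separation v v' w w' : size v = size v' -> v <> v' ->
  exists i z, [/\ (i <= size v)%N, ~ N z &
    inv (word_point (v ++ w)) ** word_point (v' ++ w') = iter (i * m) g z].
Proof.
elim: v v' => [|c v IH] [|c' v'] //= [sv] vv'.
set x := word_point (v ++ w); set y := word_point (v' ++ w').
have ginvM s t :
    inv (iter m g s) ** iter m g t = iter m g (inv s ** t).
  by rewrite iter_mul // iter_inv.
have [cc'|cc'] := eqVneq c c'.
  have [|i [z [iv Nz xyz]]] := IH v' sv.
    by move=> v_eq; apply: vv'; rewrite cc' v_eq.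
  exists i.+1, z; split=> //; rewrite ginvM mulSn iterD -xyz cc'.
  by rewrite invM -mulA mulKl.
have [Wx Wy] : W x /\ W y.
  by split; [exact: (backward_word_point _ 0)|exact: (backward_word_point _ 0)].
exists 1%N; rewrite mul1n ginvM.
exists (inv ((if c then u else e) ** x) ** ((if c' then u else e) ** y)).
split=> //; have [Nx Ny] := WN _ _ Wx Wy.
by case: c c' cc' {vv'} => [] [] // _; rewrite !mul1.
Qed.

Variables (b : nat) (V : set X).
Hypothesis b_large : (b * m + 1 < 2 ^ b)%N.
Hypothesis V_small : forall x y k, V x -> V y -> (k <= b * m)%N ->
  N (iter k f (inv x ** y)) /\ N (iter k g (inv x ** y)).

(* At each time at most one of the [2 ^ b] blocks leads into [V]. *)
Lemma avoiding_block p : exists2 v, size v = b & forall w n, (n <= b * m)%N ->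
  ~ V (iter n f (p ** word_point (v ++ w))).
Proof.
apply: contrapT => noblock.
have /choice[h hP] (v : b.-tuple bool) : exists nw : 'I_(b * m).+1 * seq bool,
    V (iter nw.1 f (p ** word_point (v ++ nw.2))).
  apply: contrapT => nohit; apply: noblock; exists v; first exact: size_tuple.
  move=> w n nbm Vn; apply: nohit; exists (Ordinal (nbm : (n < (b * m).+1)%N), w).
  exact: Vn.
have : injective (fun v => (h v).1).
  move=> v v' hv; apply: contrapT => vv'.
  have [||i [z [iv Nz xyz]]] :=
      word_point_separation v v' (h v).2 (h v').2.
  - by rewrite !size_tuple.
  - by move/val_inj.
  have /= := V_small _ _ _ (hP v) (hP v'); rewrite -hv.
  rewrite size_tuple in iv; have imb : (i * m <= b * m)%N by rewrite leq_mul2r iv orbT.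
  set n := nat_of_ord _; have nbm : (n <= b * m)%N by rewrite -ltnS; exact: ltn_ord.
  rewrite -iter_inv // -iter_mul // invM -mulA mulKl xyz => small.
  (* Two blocks entering [V] at the same time [n] have a small quotient there. Time [i * m] is at
     most [b * m] steps away, forward or backward, and at that time the quotient is [z], outside
     [N]. *)
  have [ni|/ltnW ni] := leqP n (i * m).
    have [|+ _] := small (i * m - n)%N; first by lia.
    by rewrite (iter_subn f g) // iter_cancel.
  have [|_] := small (n - i * m)%N; first by lia.
  have -> : iter n f (iter (i * m) g z) = iter (n - i * m) f z.
    by rewrite -{1}(subnK ni) iterD iter_cancel.
  by rewrite iter_cancel.
move/leq_card; rewrite card_ord card_tuple card_bool.
by rewrite leqNgt -addn1 b_large.
Qed.

Hypotheses (m_gt0 : (0 < m)%N) (clB : closed B) (clW : closed W) (oV : open V).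
Hypothesis Ne : N e.

(** The words [w k] for different [k] need not extend one another: a limit point inherits every
    closed condition, and avoiding the open set [V] is one. *)
Lemma avoiding_unstable_point :
  exists x, [/\ x <> e, backward_inside g B x & forall n, ~ V (iter n f x)].
Proof.
have b_gt0 : (0 < b)%N by case: b b_large.
have /choice[w wP] k : exists w, size w = (k * b)%N /\
    forall w' n, (n < k * b * m)%N ->
    ~ V (iter n f (u ** word_point (w ++ w'))).
  elim: k => [|k [w [sw wV]]].
    by exists [::]; split.
  (* The block is chosen relative to the point reached at time [k * b * m], and works for every
     continuation, so later blocks cannot spoil it. *)
  have [v sv vV] := avoiding_block (iter (k * b * m) f (u ** word_point w)).
  exists (w ++ v); split; first by rewrite size_cat sw sv; lia.
  move=> w' n nk; rewrite -catA.
  have [nkb|nkb] := ltnP n (k * b * m); first exact: wV.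
  rewrite -(subnK nkb) iterD iter_mul // -sw iter_word_point_cat mulA.
  by rewrite -iter_mul // sw; apply: vV; lia.
have [x xP] := compact_limit_point X_compact (fun k => u ** word_point (w k)).
exists x; split.
- have : W (inv u ** x).
    apply: (xP [set y | W (inv u ** y)]).
      apply: (continuous_closedP (fun y => inv u ** y)).1 clW => y.
      by apply: mul_cvg; [exact: cvg_cst|exact: cvg_id].
    by near=> k; rewrite /= mulKl; exact: (backward_word_point _ 0).
  (* The leading factor [u] prevents [x = e]: otherwise [inv u] lies in [W], and [WN] at [inv u] and
     [e] puts [e] outside [N]. *)
  move=> + xe; rewrite xe mule => Wu; have [+ _] := WN _ _ Wu We.
  by rewrite mulVr inv1 mul1.
- move=> j; apply: (xP (iter j g @^-1` B)); first exact: closed_iter_preimage.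
  by near=> k; apply: backward_mul => //; exact: backward_word_point.
- move=> n; apply: (xP (~` (iter n f @^-1` V))).
    apply: open_closedC; apply: open_comp => // y _.
    exact: iter_continuous.
  near=> k; have [_ /(_ [::] n)] := wP k; rewrite cats0; apply.
  have : (n < k)%N by near: k; exact: nbhs_infty_gt.
  by nia.
Unshelve. all: by end_near. Qed.

End Words.

(** * Choice of the neighbourhoods and contradiction with almost minimality *)

Lemma nbhs_iterates (N : set X) K : nbhs e N ->
  nbhs e [set d | forall k, (k <= K)%N -> N (iter k f d) /\ N (iter k g d)].
Proof.
move=> Ne; pose P k := [set d | N (iter k f d) /\ N (iter k g d)].
have eP k : nbhs e (P k).
  by apply: filterI; [apply: (iter_continuous f k f_cont)|
    apply: (iter_continuous g k g_cont)]; rewrite iter_fixed.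
elim: K => [|K IH].
  by apply: filterS (eP 0%N) => d Pd k; rewrite leqn0 => /eqP ->.
apply: filterS (filterI IH (eP K.+1)) => d [Kd Pd] k.
by rewrite leq_eqVlt => /predU1P[->//|]; rewrite ltnS; exact: Kd.
Qed.

Lemma nbhs_square (h : X -> X -> X) x (A : set X) :
  (fun p : X * X => h p.1 p.2) @ (x, x) --> h x x -> nbhs (h x x) A ->
  exists2 C, nbhs x C & forall s t, C s -> C t -> A (h s t).
Proof.
move=> ch /ch [[P Q] [/= Px Qx] PQ]; exists (P `&` Q); first exact: filterI.
by move=> s t [Ps _] [_ Qt]; exact: (PQ (s, t)).
Qed.

Lemma automorphism_not_CAM : hausdorff_space X -> regular_space X -> ~ CAM f g.
Proof.
move=> hX rX [[trans faith] dper amin].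
have accX : accessible_space X := hausdorff_accessible hX.
have cl1 x : closed [set x] := @accessible_closed_set1 _ accX x.
have finite_closed (A : set X) : finite_set A -> closed A :=
  (@accessible_finite_set_closed X).1 accX A.
have closed_nbhd (x : X) (A : set X) : nbhs x A -> exists C, [/\ closed C, nbhs x C & C `<=` A].
  move=> /(rX x A)[C Cx CA]; exists (closure C); split=> //; first exact: closed_closure.
  by apply: filterS Cx; exact: subset_closure.
have nbhd_neq (x z : X) : x <> z -> nbhs x (~` [set z]).
  by move=> xz; apply: open_nbhs_nbhs; split=> //; exact: closed_openC.
have fin_orbit_inside C : closed C -> C <> [set: X] -> finite_set (orbit_inside f g C).
  move=> clC CT; apply: amin.
  - exact: closed_orbit_inside.
  - exact: orbit_inside_invariant.
  - move=> CC; apply/CT/seteqP; split=> // x _.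
    by have : setT x by []; rewrite -CC => /(_ 0%N)[].
have [y ye] : exists y, y <> e.
  apply: contrapT => triv; have : zact f g 1 = id.
    apply/funext => x; have -> : x = e; last exact: f1.
    by apply: contrapT => xe; apply: triv; exists x.
  by move/faith.
(* An open fixed point could never be carried to [y] or any other point, against transitivity. *)
have iso : ~ open [set e].
  move=> oe.
  have [||n [_ [[_ -> <-]]]] :=
      trans [set e] (~` [set e]) oe (closed_openC (cl1 e)).
  - by exists e.
  - by exists y.
  by apply; case: n => n; rewrite /zact iter_fixed.
have {}dper : dense [set x | exists2 n, (0 < n)%N & iter n f x = x].
  move=> O O0 oO; have [x [Ox perx]] := dper O O0 oO; exists x; split=> //.
  apply: (finite_orbit_periodic f _ x (can_inj fK) perx).
  by move=> n; exists (Posz n).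
(* [B0] misses [y], so only finitely many orbits stay in it; shrinking it discards those points
   other than [e]. *)
have [B [clB Be isolating]] : exists B, [/\ closed B, nbhs e B &
    orbit_inside f g B `<=` [set e]].
  have [B0 [clB0 B0e B0y]] := closed_nbhd _ _ (nbhd_neq e y (nesym ye)).
  have finB0 : finite_set (orbit_inside f g B0 `\ e).
    apply/finite_setD/fin_orbit_inside => // B0T.
    by apply: (B0y y) => //; rewrite B0T.
  have : nbhs e (B0 `&` ~` (orbit_inside f g B0 `\ e)).
    apply: filterI => //; apply: open_nbhs_nbhs; split; last by move=> [_ /(_ erefl)].
    by apply: closed_openC; exact: finite_closed.
  move=> /closed_nbhd[B [clB Be BB0]]; exists B; split=> // x Bx.
  apply: contrapT => xe; have [_] := BB0 _ (Bx 0%N).1; apply; split=> // n.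
  by have [/BB0[? _] /BB0[? _]] := Bx n.
have [P Pe PB] : exists2 C, nbhs e C & forall s t, C s -> C t -> B (s ** t).
  apply: nbhs_square; last by rewrite mul1.
  by apply: mul_cvg; [exact: cvg_fst|exact: cvg_snd].
have [U [clU Ue UP]] := closed_nbhd _ _ Pe.
have UB : U `<=` B.
  by move=> x /UP Px; rewrite -[x]mule; apply: PB => //; exact: nbhs_singleton.
have [u ue Uu] : exists2 u, u <> e & backward_inside g U u.
  apply: unstable_point dper (cl1 e) iso => //.
  by move=> x Ux; apply: isolating => n; have [/UB ? /UB] := Ux n.
have ivue : inv u <> e by move=> iu; apply: ue; rewrite -(mulVr u) iu mule.
(* At [s = t = e] the two quotients of [WN] are [inv u] and [u]; [N1] and [N2] avoid one each, and
   by continuity so do nearby quotients. *)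
have [N1 [clN1 N1e N1u]] := closed_nbhd _ _ (nbhd_neq e (inv u) (nesym ivue)).
have [N2 [clN2 N2e N2u]] := closed_nbhd _ _ (nbhd_neq e u (nesym ue)).
have [C1 C1e C1N] : exists2 C, nbhs e C &
    forall s t, C s -> C t -> (~` N1) (inv (u ** s) ** t).
  apply: (nbhs_square (fun s t => inv (u ** s) ** t)).
    apply: mul_cvg; last exact: cvg_snd.
    apply: inv_cvg; apply: mul_cvg; last exact: cvg_fst.
    exact: cvg_cst.
  rewrite !mule; apply: open_nbhs_nbhs; split; first exact: closed_openC.
  by move=> /N1u; exact.
have [C2 C2e C2N] : exists2 C, nbhs e C &
    forall s t, C s -> C t -> (~` N2) (inv s ** (u ** t)).
  apply: (nbhs_square (fun s t => inv s ** (u ** t))).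
    apply: mul_cvg; first by apply: inv_cvg; exact: cvg_fst.
    by apply: mul_cvg; [exact: cvg_cst|exact: cvg_snd].
  rewrite mule inv1 mul1; apply: open_nbhs_nbhs; split; first exact: closed_openC.
  by move=> /N2u; exact.
have [W [clW We WC]] := closed_nbhd _ _ (filterI Pe (filterI C1e C2e)).
have [M contraction] := backward_contraction f g X_compact gK f_cont g_cont
  e B clB isolating W We.
(* The successor makes [m] positive, and [b * m + 1 = m^2 + 4 m + 1] is below [2^(m + 4)]. *)
pose m := M.+1; pose b := (m + 4)%N; pose N := N1 `&` N2.
have b_large : (b * m + 1 < 2 ^ b)%N.
  suff : (m * m + 4 * m + 8 <= 2 ^ b)%N by rewrite /b; lia.
  by rewrite /b; elim: {b}m => // k; rewrite addSn expnS; lia.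
have Ne : nbhs e N by exact: filterI.
have [D Dy DN] : exists2 C, nbhs y C & forall s t, C s -> C t ->
    [set d | forall k, (k <= b * m)%N -> N (iter k f d) /\ N (iter k g d)] (inv s ** t).
  apply: (nbhs_square (fun s t => inv s ** t)); last first.
    by rewrite mulV; exact: nbhs_iterates.
  by apply: mul_cvg; [apply: inv_cvg; exact: cvg_fst|exact: cvg_snd].
(* Removing a neighbourhood [E] of [e] from [V] leaves only finitely many backward visits of [x] to
   [V]. *)
have [E [clE Ee Ey]] := closed_nbhd _ _ (nbhd_neq e y (nesym ye)).
pose V := D^° `&` ~` E.
have oV : open V by apply: openI; [exact: open_interior|exact: closed_openC].
have [x [xe Bx Vx]] : exists x,
    [/\ x <> e, backward_inside g B x & forall n, ~ V (iter n f x)].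
  apply: (avoiding_unstable_point u m B U W N _ _ _ _ Uu _ b V) => //.
  - by move=> s t /UP Us /WC[Pt _]; exact: PB.
  - exact: nbhs_singleton.
  - exact: nbhs_singleton.
  - by move=> z j Bz mj; apply: contraction => //; exact: ltnW.
  - move=> s t /WC[_ [s1 s2]] /WC[_ [t1 t2]].
    by split=> -[]; [move=> + _; exact: C1N|move=> _; exact: C2N].
  - by move=> s t k [/interior_subset Ds _] [/interior_subset Dt _]; exact: DN.
  - exact: nbhs_singleton.
(* The forward orbit of a periodic point is part of its backward orbit, so all of it would stay in
   [B], forcing [x = e]. *)
have aperiodic n : (0 < n)%N -> iter n f x <> x.
  move=> n0 per; apply: xe; apply: isolating => k; split=> //.
  rewrite (periodic_backward g f x n k) //.
  by rewrite -{1}per iter_cancel.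
have [K Kx] := backward_contraction f g X_compact gK f_cont g_cont
  e B clB isolating E Ee.
pose F := [set iter j g x | j in `I_K].
have clF : closed F by apply: finite_closed; exact/finite_image/finite_II.
have [q [Vq [n n0 qper]]] := dper V (ex_intro _ y (conj Dy (Ey y ^~ erefl))) oV.
(* Points of [F] lie on the orbit of the nonperiodic [x], whereas [q] is periodic. *)
have Fq : ~ F q.
  move=> [j _ jq]; apply: (aperiodic n n0).
  have -> : x = iter j f q by rewrite -jq iter_cancel.
  by rewrite -iterD addnC iterD qper.
pose A := orbit_inside f g (~` (V `\` F)).
have finA : finite_set A.
  apply: fin_orbit_inside.
    by apply: open_closedC; apply: openI => //; exact: closed_openC.
  move=> AT; have : (~` (V `\` F)) q by rewrite AT.
  exact.
have Ax : A x.
  move=> k; split=> -[Vk Fk]; first exact: Vx Vk.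
  have [kK|Kk] := ltnP k K; first by apply: Fk; exists k.
  by case: Vk => _; apply; exact: Kx.
have [|k k0] := finite_orbit_periodic f A x (can_inj fK) finA; last exact: aperiodic.
elim=> // k Ak; rewrite /A -(orbit_inside_invariant f g fK gK) /=.
by exists (iter k f x).
Qed.

End Automorphism.

Theorem theorem2p12 (R : realType) (X : pseudoMetricType R)
  (mul : X -> X -> X) (inv : X -> X) (e : X)
  (alpha alpha_inv : X -> X) :
  hausdorff_space X -> compact [set: X] ->
  topological_group mul inv e ->
  (forall x y, alpha (mul x y) = mul (alpha x) (alpha y)) ->
  cancel alpha alpha_inv -> cancel alpha_inv alpha ->
  continuous alpha ->
  ~ CAM alpha alpha_inv.
Proof.
move=> hX cX X_group alphaM alphaK alpha_invK alpha_cont.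
apply: (automorphism_not_CAM mul inv e) => //.
  exact: continuous_inverse alpha_cont.
exact: uniform_regular.
Qed.
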